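(* Let $R$ be a commutative $G$-graded ring whose grading $(R,G)$ is a crossed product grading, and let $I=\bigoplus_{g\in G}I_g$ (with $I_g=I\cap R_g$) be a graded ideal of $R$. Then $I\in GSpec_s(R)$ for some $s\in h^*(R)$ if and only if $I_e\in GSpec_t(R_e)$ for some nonzero $t\in R_e$ (that is, $I_e$ is a $t$-prime ideal of the ring $R_e$).
   Context: $G$ is a group with identity $e$; rings are commutative with nonzero unity $1$. A ring $R$ is $G$-graded if $R=\bigoplus_{g\in G}R_g$ with additive subgroups $R_g$ satisfying $R_gR_h\subseteq R_{gh}$; $h(R)=\bigcup_{g\in G}R_g$ and $h^*(R)=h(R)\setminus\{0\}$. $R_e$ is a subring containing $1$. An ideal $I$ is graded if $I=\bigoplus_{g\in G}(I\cap R_g)$. $supp(R,G)=\{g\in G:R_g\neq 0\}$. The grading $(R,G)$ is a crossed product (over $supp(R,G)$) if for every $g\in supp(R,G)$, $R_g$ contains a unit; equivalently, for each $g\in supp(R,G)$, $R_g=R_eu_g$ for some unit $u_g\in R_g$. For $s\in h^*(R)$, a graded ideal $I$ of $R$ is graded $s$-prime if $s\notin I$ and, for all $a,b\in h(R)$, $ab\in I$ implies $sa\in I$ or $sb\in I$; $GSpec_s(R)$ is the set of graded $s$-prime ideals of $R$. The ring $R_e$ is regarded as trivially graded, so that an ideal $J$ of $R_e$ is in $GSpec_t(R_e)$, for $0\neq t\in R_e$, if $t\notin J$ and for all $a,b\in R_e$, $ab\in J$ implies $ta\in J$ or $tb\in J$. *)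

(* Defs.v *)
From HB Require Import structures.
From mathcomp Require Import all_boot all_order all_algebra.
From mathcomp Require Import all_classical.

Set Implicit Arguments.
Unset Strict Implicit.
Unset Printing Implicit Defensive.

Import GRing.Theory.
Local Open Scope classical_set_scope.
Local Open Scope ring_scope.

(* [A] is the internal direct sum of the [A_ g]: every element of [A] is, in a
   unique way, the sum of a finitely supported family.  The finiteness clause is
   needed because [\sum_(g \in _)] is 0 by convention on infinite supports. *)
Definition internal_direct_sum (G : groupType) (V : zmodType)
    (A_ : G -> set V) (A : set V) : Prop :=
  (forall g, A_ g `<=` A) /\
  forall x, A x -> exists! f : G -> V,
    [/\ finite_set (f @^-1` [set~ 0]),
        forall g, A_ g (f g) &
        x = \sum_(g \in [set: G]) f g].

Record is_grading (G : groupType) (R : comNzRingType) (R_ : G -> set R) : Prop :=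
  IsGrading {
    grading_zmod : forall g, GRing.zmod_closed [in R_ g];
    grading_mul : forall g h x y, R_ g x -> R_ h y -> R_ (g * h)%g (x * y);
    grading_direct_sum : internal_direct_sum R_ [set: R]
  }.

Section GradedNotions.
Variables (G : groupType) (R : comNzRingType) (R_ : G -> set R).

Definition homogeneous : set R := \bigcup_(g in [set: G]) R_ g.

Definition homogeneous_nz : set R := homogeneous `\ 0.

Definition supp : set G := [set g | R_ g <> [set 0]].

(* Invertibility is spelled out because [comNzRingType] has no unit predicate. *)
Definition crossed_product : Prop :=
  forall g, supp g -> exists2 u, R_ g u & exists v, u * v = 1.

(* [J] is an ideal of the subring [S] of [R], not necessarily proper. *)
Definition ideal_of (S J : set R) : Prop :=
  [/\ J `<=` S, GRing.zmod_closed [in J] &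
      forall a x, S a -> J x -> J (a * x)].

Definition graded_ideal (I : set R) : Prop :=
  ideal_of [set: R] I /\ internal_direct_sum (fun g => I `&` R_ g) I.

(* The common part of the two notions of s-primeness below: [H] is the set of
   elements over which the factors [a] and [b] range. *)
Definition sprime_on (H J : set R) (s : R) : Prop :=
  ~ J s /\
  forall a b, H a -> H b -> J (a * b) -> J (s * a) \/ J (s * b).

(* GSpec_s(R), for s in h^*(R). *)
Definition GSpec (s : R) : set (set R) :=
  [set I | graded_ideal I /\ sprime_on homogeneous I s].

(* GSpec_t(R_e), for 0 <> t in R_e: the trivial grading makes every ideal of R_e
   graded and every element of R_e homogeneous. *)
Definition GSpec_e (t : R) : set (set R) :=
  [set J | ideal_of (R_ 1%g) J /\ sprime_on (R_ 1%g) J t].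

End GradedNotions.

(* Main.v *)
(* If g lies in the support, then R_g contains a unit whose inverse is
   homogeneous of degree g^-1.  Multiplying by such units moves homogeneous
   elements into R_e without affecting membership in I.  Hence an s in R_g can be
   replaced by t := s w with w a unit of degree g^-1, and conversely s := t works
   because two homogeneous factors a, b can be normalised to degree e. *)
Require Import Defs.
From HB Require Import structures.
From mathcomp Require Import all_boot all_order all_algebra.
From mathcomp Require Import all_classical.

Local Open Scope classical_set_scope.
Local Open Scope ring_scope.

Import GRing.Theory.

Section CrossedProduct.
Context {G : groupType} {R : comNzRingType} {R_ : G -> set R}.
Hypothesis gradR : is_grading R_.

Lemma grading0 g : R_ g 0.
Proof. by have [+ _] := grading_zmod gradR g; rewrite inE. Qed.

(** The family [d] equal to [x] at [g] and 0 elsewhere is also a decomposition of [x], so uniqueness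
    forces [f] to agree with it at [g]. *)
Lemma homogeneous_component g x (f : G -> R) :
    R_ g x -> finite_set (f @^-1` [set~ 0]) -> (forall h, R_ h (f h)) ->
  x = \sum_(h \in [set: G]) f h -> x = f g.
Proof.
move=> xg finf fR xE; pose d h : R := if h == g then x else 0.
have dg : d g = x by rewrite /d eqxx.
have [_ /(_ x I) [F [_ Funiq]]] := grading_direct_sum gradR.
rewrite -[LHS]dg -(Funiq f) // (Funiq d) //; split.
- apply: sub_finite_set (finite_set1 g) => h /=.
  by rewrite /d; case: eqP.
- by move=> h; rewrite /d; case: eqP => [->|_]; [|exact: grading0].
- rewrite -(fsbig_widen [set g]) ?fsbig_set1 // => h [_ /=].
  by rewrite /d; case: eqP.
Qed.

(** Multiplying by [a] shifts degrees by left translation by [g]: the component of the product in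
    degree [g * h] comes only from [f h]. *)
Lemma mul_homogeneous_component {g h a} {f : G -> R} :
    R_ g a -> finite_set (f @^-1` [set~ 0]) -> (forall k, R_ k (f k)) ->
    R_ (g * h)%g (a * \sum_(k \in [set: G]) f k) ->
  a * \sum_(k \in [set: G]) f k = a * f h.
Proof.
move=> ag finf fR sumR.
rewrite -[in RHS](mulKg g h).
apply: (homogeneous_component (g * h)%g _ (fun k => a * f (g^-1 * k)%g)) => //.
(* The translated family is supported in the preimage of a finite set under an injective map. *)
- apply: (@sub_finite_set _ _ ((fun k => g^-1 * k)%g @^-1` (f @^-1` [set~ 0]))).
    by move=> k /=; apply: contra_not => ->; rewrite mulr0.
  by apply: finite_preimage finf => x y _ _; exact: mulgI.
- by move=> k; rewrite -[k in R_ k](mulVKg g); exact: grading_mul gradR _ _ _ _ ag (fR _).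
- rewrite full_fsbig_distrr; last exact: finite_setIr.
  rewrite [RHS](@reindex_fsbigT _ _ _ _ _ (fun k => g * k)%g).
    by apply: eq_fsbigr => k _; rewrite mulKg.
  by exists (fun k => g^-1 * k)%g => k; rewrite ?mulKg ?mulVKg.
Qed.

(** The degree [1%g] component of 1 acts as an identity on each homogeneous element, hence on the
    sum of the components of 1, so it equals 1. *)
Lemma grading1 : R_ 1%g 1.
Proof.
have [_ /(_ 1 I) [f [[finf fR sumf] _]]] := grading_direct_sum gradR.
suff -> : 1 = f 1%g by [].
have f1 g x : R_ g x -> f 1%g * x = x.
  move=> xg; rewrite mulrC -(mul_homogeneous_component xg finf fR) -sumf mulr1 //.
  by rewrite mulg1.
rewrite -[RHS]mulr1 sumf full_fsbig_distrr; last exact: finite_setIr.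
by apply: eq_fsbigr => g _; rewrite /= (f1 g).
Qed.

Lemma supp_of_neq0 g x : R_ g x -> x <> 0 -> supp R_ g.
Proof. by move=> xg x0 Rg0; apply: x0; rewrite Rg0 in xg. Qed.

(** The given inverse [v] of [u] may be a priori inhomogeneous. Since [u * v = 1] has degree [1%g],
    the component of [v] in degree [g^-1] is already an inverse of [u]. *)
Lemma supp_unit g : crossed_product R_ -> supp R_ g ->
  exists u w, [/\ R_ g u, R_ g^-1%g w & u * w = 1].
Proof.
move=> cpR /cpR [u ug [v uv1]].
have [_ /(_ v I) [f [[finf fR sumf] _]]] := grading_direct_sum gradR.
exists u, (f g^-1%g); split=> //.
rewrite -(mul_homogeneous_component ug finf fR) -sumf uv1 //.
by rewrite mulgV; exact: grading1.
Qed.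

End CrossedProduct.

Theorem theorem5p1 (G : groupType) (R : comNzRingType) (R_ : G -> set R)
    (gradR : is_grading R_) (cpR : crossed_product R_)
    (I : set R) (grI : graded_ideal R_ I) :
  (exists s : R, homogeneous_nz R_ s /\ GSpec R_ s I) <->
  (exists t : R, [/\ R_ 1%g t, t <> 0 & GSpec_e R_ t (I `&` R_ 1%g)]).
Proof.
have [[_ zmodI mulI] _] := grI.
have I0 : I 0 by have [+ _] := zmodI; rewrite inE.
have mulIr x a : I x -> I (x * a) by rewrite mulrC; exact: mulI.
split=> [[s [[[g _ sg] s0] [_ [sNI sI]]]]|[t [te t0 [_ [tNI tI]]]]].
- have [u [w [ug wg uw1]]] := supp_unit gradR g cpR (supp_of_neq0 g s sg s0).
  (* Recovering [s] from [s * w] shows that the latter is neither zero nor in [I]. *)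
  have sE : s = s * w * u by rewrite -mulrA (mulrC w) uw1 mulr1.
  have swe : R_ 1%g (s * w).
    by rewrite -[1%g](mulgV g); exact: grading_mul gradR _ _ _ _ sg wg.
  have mul_e x y : R_ 1%g x -> R_ 1%g y -> R_ 1%g (x * y).
    by move=> xe ye; rewrite -[1%g]mulg1; exact: grading_mul gradR _ _ _ _ xe ye.
  exists (s * w); split=> //.
    by move=> sw0; apply: s0; rewrite /= sE sw0 mul0r.
  split; first split.
  + by move=> x [].
  + split; first by rewrite inE; split=> //; exact: grading0 gradR _.
    move=> x y; rewrite !inE => -[Ix xe] [Iy ye]; split.
      by have [_ /(_ x y)] := zmodI; rewrite !inE; exact.
    by have [_ /(_ x y)] := grading_zmod gradR 1%g; rewrite !inE; exact.
  + by move=> a x ae [Ix xe]; split; [exact: mulI | exact: mul_e].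
  + split=> [[swI _]|a b ae be [abI _]].
      by apply: sNI; rewrite sE; exact: mulIr.
    have [||saI|sbI] := sI a b _ _ abI; try by exists 1%g.
    * by left; split; [rewrite mulrAC; exact: mulIr | exact: mul_e].
    * by right; split; [rewrite mulrAC; exact: mulIr | exact: mul_e].
- exists t; split; first by split=> //; exists 1%g.
  split=> //; split=> [tIn|a b [g _ ag] [h _ bh] abI]; first exact: tNI.
  (* Only a nonzero factor guarantees that its degree lies in the support, where units are
     available. *)
  have [->|/eqP a0] := eqVneq a 0; first by left; rewrite mulr0.
  have [->|/eqP b0] := eqVneq b 0; first by right; rewrite mulr0.
  have [u [w [_ wg uw1]]] := supp_unit gradR g cpR (supp_of_neq0 g a ag a0).
  have [u' [w' [_ wh uw1']]] := supp_unit gradR h cpR (supp_of_neq0 h b bh b0).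
  have awe : R_ 1%g (a * w).
    by rewrite -[1%g](mulgV g); exact: grading_mul gradR _ _ _ _ ag wg.
  have bwe : R_ 1%g (b * w').
    by rewrite -[1%g](mulgV h); exact: grading_mul gradR _ _ _ _ bh wh.
  (* Multiplying by the inverse [y] of [z] undoes the normalisation without leaving [I]. *)
  have unnormalise x y z : y * z = 1 -> I (t * (x * z)) -> I (t * x).
    by move=> yz1 /(mulIr _ y); rewrite -!mulrA (mulrC z) yz1 mulr1.
  have [|[awI _]|[bwI _]] := tI _ _ awe bwe.
  (* The product of the normalised factors is [(a * b) * (w * w')], a multiple of [a * b]. *)
  + split; first by rewrite mulrACA; exact: mulIr.
    by rewrite -[1%g]mulg1; exact: grading_mul gradR _ _ _ _ awe bwe.
  + by left; exact: unnormalise uw1 awI.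
  + by right; exact: unnormalise uw1' bwI.
Qed.
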